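(* Let $H\equiv O(N_1)\times O(N_2)\times\dots\times O(N_r)$ be a maximal orthogonal Borel subgroup of $O(N)$, let $\pi=(N_1,\dots,N_r)$ be the corresponding partition of $N$, and let $n_1,\dots,n_q$ be the distinct values in the sequence $N_1,\dots,N_r$. Then the Weyl group of $H$ is equal to $$\mathcal{W}(H)=\mathfrak{S}_\pi=\mathfrak{S}(\phi_\pi(n_1))\times\mathfrak{S}(\phi_\pi(n_2))\times\dots\times\mathfrak{S}(\phi_\pi(n_q))=\mathfrak{S}(\phi_\pi(1))\times\mathfrak{S}(\phi_\pi(2))\times\dots\times\mathfrak{S}(\phi_\pi(N)),$$ with the convention that $\mathfrak{S}(\emptyset)=e$.
   Context: The maximal orthogonal Borel subgroup associated with an orthogonal decomposition $\mathbb{R}^N=\bigoplus_{j=1}^r V_j$, $\dim V_j=N_j\geq 1$, is $H=O(V_1)\times\dots\times O(V_r)\equiv O(N_1)\times\dots\times O(N_r)$. $\mathcal{W}(H)=\mathcal{N}(H)/H$, with $\mathcal{N}(H)$ the normalizer of $H$ in $O(N)$. $\phi_\pi(n)=\{1\le j\le r:N_j=n\}$; $\mathfrak{S}(A)$ is the permutation group of a finite set $A$; $\mathfrak{S}_\pi$ is the group of permutations $\sigma$ of $\{1,\dots,r\}$ with $N_{\sigma(j)}=N_j$ for all $j$. Equality of $\mathcal{W}(H)$ with $\mathfrak{S}_\pi$ is via the natural identification in which $\sigma$ permutes the summands $V_j$ of equal dimension. *)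

(* Defs.v *)
From HB Require Import structures.
From mathcomp Require Import all_boot all_order all_fingroup all_algebra.
From mathcomp Require Import generic_quotient boolp reals.

Set Implicit Arguments.
Unset Strict Implicit.
Unset Printing Implicit Defensive.

Import GRing.Theory Num.Theory.

Local Open Scope ring_scope.
Local Open Scope quotient_scope.

Section Weyl.
Variables (G : groupType) (H : groupClosed G).
Local Open Scope group_scope.

(* h ^ g is g^-1 * (h * g), so this says g^-1 H g = H. *)
Definition normalizer : {pred G} :=
  [pred g | `[< forall h, (h ^ g \in H) = (h \in H) >]].

Lemma normalizerP g :
  reflect (forall h, (h ^ g \in H) = (h \in H)) (g \in normalizer).
Proof. exact: asboolP. Qed.

Lemma normalizer_group_closed : group_closed normalizer.
Proof.
split=> [|x y /normalizerP nx /normalizerP ny].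
  by apply/normalizerP => h; rewrite conjg1.
by apply/normalizerP => h; rewrite conjgM -[LHS]ny conjgKV nx.
Qed.

Definition normalizer_group := {g : G | g \in normalizer}.
HB.instance Definition _ := SubChoice.on normalizer_group.
HB.instance Definition _ :=
  SubChoice_isSubGroup.Build G _ normalizer_group normalizer_group_closed.

(* x H = y H *)
Definition same_coset (x y : normalizer_group) : bool :=
  (val x)^-1 * val y \in H.

Lemma same_coset_refl : reflexive same_coset.
Proof. by move=> x; rewrite /same_coset mulVg gpred1. Qed.

Lemma same_coset_sym : symmetric same_coset.
Proof.
by move=> x y; rewrite /same_coset -[LHS]gpredV invgM invgK.
Qed.

Lemma same_coset_trans : transitive same_coset.
Proof.
move=> y x z; rewrite /same_coset => xy yz.
by rewrite -[val z](mulKVg (val y)) mulgA gpredM.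
Qed.

Canonical same_coset_equiv :=
  EquivRel same_coset same_coset_refl same_coset_sym same_coset_trans.

Definition weyl := {eq_quot same_coset}.
HB.instance Definition _ := Choice.on weyl.
HB.instance Definition _ := EqQuotient.on weyl.

Definition weyl_one : weyl := \pi 1.
Definition weyl_inv := lift_op1 weyl (fun x => x^-1).
Definition weyl_mul := lift_op2 weyl (fun x y => x * y).

Lemma same_cosetP (x y : normalizer_group) :
  reflect (\pi_weyl x = \pi_weyl y) (same_coset x y).
Proof. exact: (eqquotP weyl). Qed.

Lemma normalizer_conj (x : normalizer_group) h : (h ^ val x \in H) = (h \in H).
Proof. by move/normalizerP: (valP x). Qed.

Lemma pi_weyl_inv : {morph \pi_weyl : x / x^-1 >-> weyl_inv x}.
Proof.
move=> x; unlock weyl_inv; apply/same_cosetP; rewrite /same_coset.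
have /esym/same_cosetP := reprK (\pi_weyl x); rewrite /same_coset.
set y := repr _ => xy; rewrite !gmulfV invgK -(normalizer_conj x).
have -> : (val x * (val y)^-1) ^ val x = ((val x)^-1 * val y)^-1.
  by rewrite conjgE invgM invgK !mulgA mulVg mul1g.
by rewrite gpredV.
Qed.

Lemma pi_weyl_mul : {morph \pi_weyl : x y / x * y >-> weyl_mul x y}.
Proof.
move=> x y; unlock weyl_mul; apply/same_cosetP; rewrite /same_coset.
have /esym/same_cosetP := reprK (\pi_weyl x); rewrite /same_coset.
have /esym/same_cosetP := reprK (\pi_weyl y); rewrite /same_coset.
set x' := repr (\pi_weyl x); set y' := repr (\pi_weyl y) => yH xH.
rewrite !valM invgM.
have -> : (val y)^-1 * (val x)^-1 * (val x' * val y')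
        = ((val x)^-1 * val x') ^ val y * ((val y)^-1 * val y').
  by rewrite conjgE !mulgA mulgK.
by rewrite gpredM ?normalizer_conj.
Qed.

Lemma weyl_mulA : associative weyl_mul.
Proof.
by elim/quotW=> x; elim/quotW=> y; elim/quotW=> z; rewrite -!pi_weyl_mul mulgA.
Qed.

Lemma weyl_mul1 : left_id weyl_one weyl_mul.
Proof. by elim/quotW=> x; rewrite -pi_weyl_mul mul1g. Qed.

Lemma weyl_mulr1 : right_id weyl_one weyl_mul.
Proof. by elim/quotW=> x; rewrite -pi_weyl_mul mulg1. Qed.

Lemma weyl_mulV : left_inverse weyl_one weyl_inv weyl_mul.
Proof. by elim/quotW=> x; rewrite -pi_weyl_inv -pi_weyl_mul mulVg. Qed.

Lemma weyl_mulrV : right_inverse weyl_one weyl_inv weyl_mul.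
Proof. by elim/quotW=> x; rewrite -pi_weyl_inv -pi_weyl_mul mulgV. Qed.

HB.instance Definition _ := isGroup.Build weyl
  weyl_mulA weyl_mul1 weyl_mulr1 weyl_mulV weyl_mulrV.

End Weyl.

Section Orthogonal.
Variables (R : realType) (N : nat).

Record orthogonal_group := Orthogonal {
  orthogonal_mx :> 'M[R]_N;
  _ : orthogonal_mx *m orthogonal_mx^T == 1%:M
}.

HB.instance Definition _ := [isSub for orthogonal_mx].
HB.instance Definition _ := [Choice of orthogonal_group by <:].

Lemma orthogonalP (A : orthogonal_group) : A *m A^T = 1%:M.
Proof. exact/eqP/(valP A). Qed.

Lemma orthogonal1_subproof : (1%:M : 'M[R]_N) *m 1%:M^T == 1%:M.
Proof. by rewrite trmx1 mulmx1. Qed.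

Lemma orthogonalV_subproof (A : orthogonal_group) : A^T *m A^T^T == 1%:M.
Proof. by rewrite trmxK (mulmx1C (orthogonalP A)). Qed.

Lemma orthogonalM_subproof (A B : orthogonal_group) :
  (A *m B) *m (A *m B)^T == 1%:M.
Proof.
by rewrite trmx_mul mulmxA -(mulmxA A B) orthogonalP mulmx1 orthogonalP.
Qed.

Definition orthogonal_one := Orthogonal orthogonal1_subproof.
Definition orthogonal_inv A := Orthogonal (orthogonalV_subproof A).
Definition orthogonal_mul A B := Orthogonal (orthogonalM_subproof A B).

Lemma orthogonal_mulA : associative orthogonal_mul.
Proof. by move=> A B C; apply: val_inj; rewrite /= mulmxA. Qed.
Lemma orthogonal_mul1 : left_id orthogonal_one orthogonal_mul.
Proof. by move=> A; apply: val_inj; rewrite /= mul1mx. Qed.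
Lemma orthogonal_mulr1 : right_id orthogonal_one orthogonal_mul.
Proof. by move=> A; apply: val_inj; rewrite /= mulmx1. Qed.
Lemma orthogonal_mulrV :
  right_inverse orthogonal_one orthogonal_inv orthogonal_mul.
Proof. by move=> A; apply: val_inj; rewrite /= orthogonalP. Qed.
Lemma orthogonal_mulV :
  left_inverse orthogonal_one orthogonal_inv orthogonal_mul.
Proof. by move=> A; apply: val_inj; rewrite /= (mulmx1C (orthogonalP A)). Qed.

HB.instance Definition _ := isGroup.Build orthogonal_group
  orthogonal_mulA orthogonal_mul1 orthogonal_mulr1
  orthogonal_mulV orthogonal_mulrV.

Definition dotr (u v : 'rV[R]_N) : R := (u *m v^T) 0 0.

(* Vectors are rows and g acts by v |-> v *m g. This is a right action, so it
   composes in the same order as permutations: (s * t) x = t (s x). *)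
Definition orthogonal_end (g : orthogonal_group) : 'End('rV[R]_N) :=
  linfun (mulmxr g).

(* O(V) as a subgroup of O(N): its elements are extended by the identity
   on the orthogonal complement of V. *)
Definition orthogonal_on (V : {vspace 'rV[R]_N}) : {pred orthogonal_group} :=
  [pred g | `[< (orthogonal_end g @: V <= V)%VS /\
                forall w, (forall v, v \in V -> dotr v w = 0) ->
                          orthogonal_end g w = w >]].

(* Orthogonality makes the sum direct. *)
Record orthogonal_decomposition (r : nat) := OrthogonalDecomposition {
  summand :> 'I_r -> {vspace 'rV[R]_N};
  summand_orthogonal : forall i j, i != j ->
    forall u v, u \in summand i -> v \in summand j -> dotr u v = 0;
  summand_sum : (\sum_j summand j)%VS = fullv;
  summand_dim_gt0 : forall j, (0 < \dim (summand j))%N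
}.

Section Borel.
Variables (r : nat) (V : orthogonal_decomposition r).

(* The (internal) product O(V_1) x ... x O(V_r). *)
Definition borel_pred : {pred orthogonal_group} :=
  [pred g | `[< exists h : 'I_r -> orthogonal_group,
                  (forall j, h j \in orthogonal_on (V j)) /\
                  g = (\prod_j h j)%g >]].

Lemma orthogonal_endE (g : orthogonal_group) v : orthogonal_end g v = v *m g.
Proof. by rewrite lfunE. Qed.

Lemma orthogonal_onP (U : {vspace 'rV[R]_N}) (g : orthogonal_group) :
  reflect ((forall v, v \in U -> v *m g \in U) /\
           forall w, (forall v, v \in U -> dotr v w = 0) -> w *m g = w)
          (g \in orthogonal_on U).
Proof.
apply: (iffP (asboolP _)) => -[gU gC]; split.
- move=> v vU; rewrite -orthogonal_endE.
  by apply: (subvP gU); apply: memv_img.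
- by move=> w /gC; rewrite orthogonal_endE.
- by apply/subvP => _ /memv_imgP[v vU ->]; rewrite orthogonal_endE gU.
- by move=> w /gC; rewrite orthogonal_endE.
Qed.

Lemma borelP (g : orthogonal_group) :
  reflect (exists2 h : 'I_r -> orthogonal_group,
             forall j, h j \in orthogonal_on (V j) &
             forall j v, v \in V j -> v *m g = v *m h j)
          (g \in borel_pred).
Proof.
have prodE (h : 'I_r -> orthogonal_group) j v :
    (forall j, h j \in orthogonal_on (V j)) ->
    v \in V j -> v *m (\prod_j h j)%g = v *m h j.
  move=> hV vj.
  have fixV i w : i != j -> w \in V j -> w *m h i = w.
    move=> ij wj; have /orthogonal_onP[_] := hV i; apply=> u ui.
    exact: (summand_orthogonal ij ui wj).
  have stab w : w \in V j -> w *m h j \in V j.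
    by have /orthogonal_onP[+ _] := hV j; apply.
  suff sE (s : seq 'I_r) w : uniq s -> w \in V j ->
      w *m (\prod_(i <- s) h i)%g = if j \in s then w *m h j else w.
    by rewrite sE ?index_enum_uniq ?mem_index_enum.
  elim: s w => [|i s IHs] w /=; first by rewrite big_nil /= mulmx1.
  case/andP=> nis us wj; rewrite big_cons /= mulmxA in_cons.
  have [ji|ji] := eqVneq j i.
    by rewrite -ji IHs ?stab // ji (negPf nis).
  by rewrite fixV ?IHs // eq_sym.
apply: (iffP (asboolP _)) => [[h [hV ->]]|[h hV gh]]; exists h => //.
  by move=> j v vj; exact: prodE.
split=> //; apply: val_inj; apply/row_matrixP => i; rewrite !rowE.
have : delta_mx 0 i \in (\sum_j V j)%VS by rewrite summand_sum memvf.
case/memv_sumP => u uV ->; rewrite !mulmx_suml.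
by apply: eq_bigr => j _; rewrite (prodE h j) ?(gh j) ?uV.
Qed.

Lemma orthogonal_on_inv (U : {vspace 'rV[R]_N}) (g : orthogonal_group) :
  g \in orthogonal_on U -> (g^-1)%g \in orthogonal_on U.
Proof.
case/orthogonal_onP=> gU gC; apply/orthogonal_onP; split; last first.
  by move=> w /gC {1}<-; rewrite -mulmxA orthogonalP mulmx1.
have inj : (U :&: lker (orthogonal_end g))%VS = 0%VS.
  suff /eqP-> : lker (orthogonal_end g) == 0%VS by rewrite capv0.
  apply/lker0P => x y; rewrite !orthogonal_endE => /(congr1 (mulmxr g^T)) /=.
  by rewrite -!mulmxA orthogonalP !mulmx1.
have eU : (orthogonal_end g @: U)%VS = U.
  apply/eqP; rewrite eqEdim (limg_dim_eq inj) leqnn andbT.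
  by apply/subvP => _ /memv_imgP[v vU ->]; rewrite orthogonal_endE gU.
move=> v; rewrite -{1}eU => /memv_imgP[u uU ->].
by rewrite orthogonal_endE -mulmxA orthogonalP mulmx1.
Qed.

Lemma borel1 : (1%g : orthogonal_group) \in borel_pred.
Proof.
apply/borelP; exists (fun=> 1%g) => // j; apply/orthogonal_onP.
by split=> v; rewrite mulmx1.
Qed.

Lemma borelM : mulg_closed borel_pred.
Proof.
move=> g g' /borelP[h hV gh] /borelP[k kV gk].
have gkh j v : v \in V j -> v *m (g * g')%g = v *m (h j * k j)%g.
  move=> vj; rewrite /= !mulmxA (gh j) // (gk j) //.
  by have /orthogonal_onP[+ _] := hV j; apply.
apply/borelP; exists (fun j => h j * k j)%g => // j.
have /orthogonal_onP[hj hC] := hV j; have /orthogonal_onP[kj kC] := kV j.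
apply/orthogonal_onP; split=> v; rewrite /= mulmxA.
  by move=> /hj/kj.
by move=> vC; rewrite hC // kC.
Qed.

Lemma borelV : invg_closed borel_pred.
Proof.
move=> g /borelP[h hV gh]; apply/borelP; exists (fun j => (h j)^-1)%g.
  by move=> j; exact: orthogonal_on_inv.
move=> j v vj; have /orthogonal_onP[+ _] := orthogonal_on_inv (hV j).
move=> /(_ _ vj) wj.
have {1}-> : v = v *m (h j)^-1%g *m h j.
  by rewrite -mulmxA (mulmx1C (orthogonalP _)) mulmx1.
by rewrite -(gh j) // -mulmxA orthogonalP mulmx1.
Qed.

HB.instance Definition _ := isMulClosed.Build orthogonal_group borel_pred borelM.
HB.instance Definition _ := isMul1Closed.Build orthogonal_group borel_pred borel1.
HB.instance Definition _ := isInvClosed.Build orthogonal_group borel_pred borelV.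

Definition borel : groupClosed orthogonal_group := borel_pred.

Definition summand_dim (j : 'I_r) : nat := \dim (V j).

End Borel.
End Orthogonal.

Section SymmetricGroups.

Definition sym_group (T : finType) (A : {set T}) : finGroupType :=
  {perm {x : T | x \in A}}.

Variables (r : nat) (p : 'I_r -> nat).

Definition phi (n : nat) : {set 'I_r} := [set j | p j == n].

Definition sym_partition : {set 'S_r} :=
  [set s : 'S_r | [forall j, p (s j) == p j]].

Lemma sym_partition_group_set : group_set sym_partition.
Proof.
apply/group_setP; split=> [|s t].
  by rewrite inE; apply/forallP=> j; rewrite perm1.
rewrite !inE => /forallP sp /forallP tp; apply/forallP => j.
by rewrite permM (eqP (tp _)).
Qed.

Canonical sym_partition_group := Group sym_partition_group_set.

End SymmetricGroups.

(* Main.v *)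
(* H consists of the g in O(N) that preserve every V j. The reflection s_u
   belongs to H exactly when u lies in some V k, and g^-1 s_u g = s_(u g), so an
   element of the normalizer maps the union of the V k to itself. Since the V k
   are pairwise orthogonal, it then maps each V j into a single V k, and
   applying this to g^-1 makes it permute the summands. This gives an injective
   morphism from N(H)/H to permutations preserving dimensions; it is onto
   because matching orthonormal bases of summands of equal dimension defines an
   element of O(N). A permutation preserving dimensions amounts to its
   restrictions to the sets of summands of each given dimension. *)
From HB Require Import structures.
Require Import Defs.
From mathcomp Require Import all_boot all_order all_fingroup all_algebra.
From mathcomp Require Import generic_quotient boolp reals.

Set Implicit Arguments.
Unset Strict Implicit.
Unset Printing Implicit Defensive.

Import Order.TTheory GRing.Theory Num.Theory.
Local Open Scope ring_scope.

(** Maps obtained by choice come as bare functions; this bundles them as morphisms, as the final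
    statement requires. *)
Lemma multiplicative_exists (G H : magmaType) (f : G -> H) :
  {morph f : x y / (x * y)%g} ->
  exists F : {multiplicative G -> H}, forall x, F x = f x.
Proof.
move=> fM; pose M := isMultiplicative.Build G H f fM.
by exists (HB.pack_for {multiplicative G -> H} f M).
Qed.

(** * Restricting permutations to the level sets of [p] *)

Section Restriction.
Variables (r : nat) (p : 'I_r -> nat) (I : finType) (c : I -> nat).
Hypotheses (c_inj : injective c) (c_onto : forall j, exists i, p j = c i).

(** By [c_inj] and [c_onto] every index lies in exactly one level set [phi p (c i)], so a
    permutation preserving [p] is the same as a family of permutations of these sets. Values of [c]
    outside the range of [p] give empty sets, hence trivial factors; this lets one lemma serve both
    product decompositions. *)
Lemma sym_partition_prod :
  exists Psi : {multiplicative [subg sym_partition p] ->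
                  {dffun forall i : I, sym_group (phi p (c i))}},
    bijective Psi /\ (forall s i x, val (Psi s i x) = sgval s (val x)).
Proof.
have ex_restr (s : [subg sym_partition p]) :
    exists f : {dffun forall i : I, sym_group (phi p (c i))},
      forall i x, val (f i x) = sgval s (val x).
  have sp j : p (sgval s j) = p j.
    by have := subgP s; rewrite inE => /forallP/(_ j)/eqP.
  have sx i (x : {x | x \in phi p (c i)}) : sgval s (val x) \in phi p (c i).
    by have := valP x; rewrite !inE sp.
  pose f i (x : {x | x \in phi p (c i)}) : {x | x \in phi p (c i)} :=
    Sub (sgval s (val x)) (sx i x).
  have f_inj i : injective (f i).
    by move=> x y /(congr1 val) /perm_inj /val_inj.
  exists [ffun i => perm (f_inj i) : sym_group (phi p (c i))] => i x.
  by rewrite ffunE permE SubK.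
have [f fE] := choice ex_restr.
have fM : {morph f : s t / (s * t)%g}.
  move=> s t; apply/ffunP => i; rewrite dffunM; apply/permP => x.
  by apply: val_inj; rewrite permM !fE /= permM.
have [Psi PsiE] := multiplicative_exists fM.
exists Psi; split; last by move=> s i x; rewrite PsiE fE.
have Psi_inj : injective Psi.
  move=> s t; rewrite !PsiE => ft; apply: val_inj; apply/permP => j.
  have [i pj] := c_onto j; have jP : j \in phi p (c i) by rewrite inE pj.
  by have /= := fE s i (Sub j jP); rewrite ft fE.
suff /choice[g gK] : forall h, exists s, Psi s = h.
  by exists g => // s; apply: Psi_inj; rewrite gK.
move=> h.
(* The glued map is specified for every level and every membership proof, so that [sE] applies to
   whichever proof occurs later; both are in fact unique. *)
have /choice[s sE] j : exists k, forall i (jP : j \in phi p (c i)),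
    k = val (h i (Sub j jP)).
  have [i pj] := c_onto j; have jP : j \in phi p (c i) by rewrite inE pj.
  exists (val (h i (Sub j jP))) => i' jP'.
  have ii' : i = i' by apply: c_inj; rewrite -pj; move: jP'; rewrite inE => /eqP.
  by case: i' / ii' jP' => jP'; rewrite (bool_irrelevance jP jP').
have sp j : p (s j) = p j.
  have [i pj] := c_onto j; have jP : j \in phi p (c i) by rewrite inE pj.
  by rewrite (sE j i jP) pj; apply/eqP; have := valP (h i (Sub j jP)); rewrite inE.
have s_inj : injective s.
  move=> j k sjk; have [i pj] := c_onto j.
  have jP : j \in phi p (c i) by rewrite inE pj.
  (* Since [s] preserves [p], equal images force [j] and [k] into the same level set, where [h i] is
     injective. *)
  have kP : k \in phi p (c i) by rewrite inE -pj -sp -sjk sp.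
  move: sjk; rewrite (sE j i jP) (sE k i kP).
  by move=> /val_inj/perm_inj/(congr1 val).
have sP : perm s_inj \in sym_partition p.
  by rewrite inE; apply/forallP => j; rewrite permE sp.
exists (subg _ (perm s_inj)); rewrite PsiE; apply/ffunP => i; apply/permP => x.
apply: val_inj; rewrite fE subgK // permE (sE _ i (valP x)).
by congr (val (h i _)); apply: val_inj.
Qed.

End Restriction.

(** * Orthonormal frames and orthogonal projectors *)

Section Frames.
Variables (R : realType) (N : nat).
Implicit Types (U : {vspace 'rV[R]_N}) (u v w : 'rV[R]_N).

Lemma dotrC u v : dotr u v = dotr v u.
Proof. by rewrite /dotr -[u *m v^T]trmxK [LHS]mxE trmx_mul trmxK. Qed.

Lemma dotrDl u v w : dotr (u + v) w = dotr u w + dotr v w.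
Proof. by rewrite /dotr mulmxDl mxE. Qed.

Lemma dotrE u v : u *m v^T = (dotr u v)%:M.
Proof. exact: mx11_scalar. Qed.

Lemma dotr_eq0 u : (dotr u u == 0) = (u == 0).
Proof.
apply/eqP/eqP => [|->]; last by rewrite /dotr mul0mx mxE.
rewrite /dotr mxE => /eqP; rewrite psumr_eq0 => [/allP u0|i _]; last first.
  by rewrite mxE -expr2 sqr_ge0.
apply/rowP => i; rewrite mxE; apply/eqP.
by have := u0 i (mem_index_enum _); rewrite mxE -expr2 sqrf_eq0.
Qed.

Lemma dotr_gt0 u : u != 0 -> 0 < dotr u u.
Proof.
rewrite -dotr_eq0 lt_def => -> /=; rewrite /dotr mxE.
by apply: sumr_ge0 => i _; rewrite mxE -expr2 sqr_ge0.
Qed.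

(** Gram-Schmidt by induction on the dimension: normalise one vector [u] of [U], then take a frame
    of the orthogonal complement of [u] in [U]. The rows of [B] form the basis. *)
Lemma orthonormal_frame d U : \dim U = d ->
  exists B : 'M[R]_(d, N),
    B *m B^T = 1%:M /\ forall v, v \in U <-> exists w : 'rV[R]_d, v = w *m B.
Proof.
elim: d U => [|d IHd] U dimU.
  exists 0; split=> [|v]; first by apply/matrixP => -[].
  move/eqP: dimU; rewrite dimv_eq0 => /eqP->; rewrite memv0.
  by split=> [/eqP->|[w ->]]; [exists 0 |]; rewrite mulmx0.
have U0 : vpick U != 0 by rewrite vpick0 -dimv_eq0 dimU.
have pU := memv_pick U; set p := vpick U in U0 pU.
pose u := (Num.sqrt (dotr p p))^-1 *: p.
have uu : u *m u^T = 1%:M.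
  rewrite linearZ /= -scalemxAl -scalemxAr dotrE scalerA scale_scalar_mx.
  by rewrite -invfM -expr2 sqr_sqrtr ?ltW ?dotr_gt0 // mulVf // dotr_eq0.
have uU : u \in U by rewrite memvZ.
pose f := linfun (mulmxr u^T : 'rV[R]_N -> 'M[R]_1).
have fE v : f v = v *m u^T by rewrite lfunE.
have dimK : \dim (U :&: lker f) = d.
  (* Rank-nullity for the inner product with [u]: its image on [U] is at most a line, and nonzero
     because [f u] is 1. *)
  suff dimf : \dim (f @: U) = 1%N.
    by have := limg_ker_dim f U; rewrite dimf dimU addn1 => -[].
  apply/eqP; rewrite eqn_leq lt0n dimv_eq0; apply/andP; split.
    by rewrite (leq_trans (dimvS (subvf _))) // dimvf /dim /=.
  apply/eqP => fU0; have := memv_img f uU; rewrite fU0 memv0 fE uu.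
  by rewrite -scalemx1 scaler_eq0 !oner_eq0.
have [B [BB BU]] := IHd _ dimK.
have Bu : B *m u^T = 0.
  apply/row_matrixP => i; rewrite row_mul row0 rowE.
  have /memv_capP[_] : delta_mx 0 i *m B \in (U :&: lker f)%VS.
    by apply/BU; exists (delta_mx 0 i).
  by rewrite memv_ker fE => /eqP.
rewrite -[d.+1]/(1 + d)%N; exists (col_mx u B); split=> [|v].
  rewrite tr_col_mx mul_col_row uu BB Bu.
  by rewrite -[u *m B^T]trmxK trmx_mul trmxK Bu trmx0 -scalar_mx_block.
split=> [vU|[w ->]].
  have : v - v *m u^T *m u \in (U :&: lker f)%VS.
    rewrite memv_cap memv_ker fE mulmxBl -(mulmxA _ u) uu mulmx1 subrr eqxx andbT.
    by rewrite memvB // dotrE mul_scalar_mx memvZ.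
  case/BU => w vw; exists (row_mx (v *m u^T) w).
  by rewrite mul_row_col -vw addrC subrK.
rewrite -[w]hsubmxK mul_row_col memvD //.
  by rewrite [lsubmx _]mx11_scalar mul_scalar_mx memvZ.
by have /memv_capP[] : rsubmx w *m B \in (U :&: lker f)%VS by apply/BU; eexists.
Qed.

Lemma frame_orthogonal d (B : 'M[R]_(d, N)) w :
  (forall u : 'rV[R]_d, dotr w (u *m B) = 0) -> w *m B^T = 0.
Proof.
move=> wB; apply/rowP => i; rewrite mxE [RHS]mxE.
have := wB (delta_mx 0 i); rewrite -rowE /dotr mxE => wi.
by rewrite -[RHS]wi; apply: eq_bigr => k _; rewrite !mxE.
Qed.

Lemma orthogonal_projector U : exists P : 'M[R]_N,
  [/\ P^T = P, forall v, v *m P \in U, forall v, v \in U -> v *m P = v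
    & forall w, (forall v, v \in U -> dotr v w = 0) -> w *m P = 0].
Proof.
have [B [BB BU]] := orthonormal_frame (erefl (\dim U)).
exists (B^T *m B); split.
- by rewrite trmx_mul trmxK.
- by move=> v; apply/BU; exists (v *m B^T); rewrite mulmxA.
- by move=> v /BU[w ->]; rewrite -mulmxA (mulmxA B) BB mul1mx.
- move=> w wU; rewrite mulmxA frame_orthogonal ?mul0mx // => u.
  by rewrite dotrC wU //; apply/BU; exists u.
Qed.

(** * Orthogonal maps and reflections *)

Lemma dotr_orthogonal (g : orthogonal_group R N) u v :
  dotr (u *m g) (v *m g) = dotr u v.
Proof. by rewrite /dotr trmx_mul mulmxA -(mulmxA u) Defs.orthogonalP mulmx1. Qed.

Lemma mulmx_orthogonalK (g : orthogonal_group R N) u : u *m g *m g^-1%g = u.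
Proof. by rewrite -mulmxA Defs.orthogonalP mulmx1. Qed.

Lemma mulmx_orthogonalVK (g : orthogonal_group R N) u : u *m g^-1%g *m g = u.
Proof. by rewrite -mulmxA (mulmx1C (Defs.orthogonalP g)) mulmx1. Qed.

(* For u = 0 the junk value 0^-1 = 0 makes this the identity, so it is
   orthogonal for every u. *)
Definition reflection_mx u : 'M[R]_N := 1%:M - (2 / dotr u u) *: (u^T *m u).

Lemma reflection_subproof u :
  reflection_mx u *m (reflection_mx u)^T == 1%:M.
Proof.
rewrite /reflection_mx; set c := 2 / _.
rewrite linearB /= [(c *: _)^T]linearZ trmx1 /= trmx_mul trmxK mulmxBl mul1mx.
rewrite -scalemxAl mulmxBr mulmx1 -scalemxAr mulmxA -(mulmxA u^T u) dotrE.
rewrite mul_mx_scalar -scalemxAl scalerBr !scalerA.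
(* With this, the quadratic term of the product cancels the two cross terms. *)
have -> : c * (c * dotr u u) = c + c.
  have [u0|u0] := eqVneq (dotr u u) 0; first by rewrite /c u0 invr0 !mulr0 addr0.
  by rewrite {2}/c divfK // mulr_natr mulr2n.
by rewrite scalerDl opprB addrK subrK.
Qed.

Definition reflection u : orthogonal_group R N :=
  Orthogonal (reflection_subproof u).

Lemma mulmx_reflection u v :
  v *m reflection u = v - (2 / dotr u u * dotr v u) *: u.
Proof.
rewrite /= mulmxBr mulmx1 -scalemxAr mulmxA dotrE mul_scalar_mx.
by rewrite scalerA.
Qed.

Lemma reflection_conj (g : orthogonal_group R N) u :
  (reflection u ^ g)%g = reflection (u *m g).
Proof.
apply: val_inj => /=; rewrite mulmxBl mul1mx mulmxBr (mulmx1C (Defs.orthogonalP g)).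
rewrite /reflection_mx dotr_orthogonal -scalemxAl -scalemxAr.
by rewrite trmx_mul !mulmxA.
Qed.

End Frames.

(** * Stability of the summands characterises H; reflections in H *)

Section OrthogonalDecomposition.
Variables (R : realType) (N r : nat) (V : orthogonal_decomposition R N r).
Implicit Types (g : orthogonal_group R N) (u v w : 'rV[R]_N).

Lemma summand_sumP v :
  exists2 u : 'I_r -> 'rV[R]_N, forall j, u j \in V j & v = \sum_j u j.
Proof.
have : v \in (\sum_j V j)%VS by rewrite summand_sum memvf.
by case/memv_sumP => u uV ->; exists u => // j; apply: uV.
Qed.

Lemma eq_mx_on_summands (A B : 'M[R]_N) :
  (forall j v, v \in V j -> v *m A = v *m B) -> A = B.
Proof.
move=> AB; apply/row_matrixP => i; rewrite !rowE.
have [u uV ->] := summand_sumP (delta_mx 0 i).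
by rewrite !mulmx_suml; apply: eq_bigr => j _; apply: AB.
Qed.

Lemma summand_neq0 j : exists2 v, v \in V j & v != 0.
Proof.
exists (vpick (V j)); first exact: memv_pick.
by rewrite vpick0 -dimv_eq0 -lt0n summand_dim_gt0.
Qed.

Lemma summand_uniq i j v : v != 0 -> v \in V i -> v \in V j -> i = j.
Proof.
move=> v0 vi vj; apply: contraNeq v0 => ij; rewrite -dotr_eq0.
by rewrite (summand_orthogonal ij vi vj).
Qed.

Lemma summand_inj : injective V.
Proof.
move=> i j Vij; have [v vi v0] := summand_neq0 i.
by apply: (summand_uniq v0); rewrite // -Vij.
Qed.

(** Conversely, if [g] preserves each summand, its restriction to [V j], extended by the identity on
    the orthogonal complement, is the factor in O(V_j). *)
Lemma borel_stableP g :
  (g \in borel V) <-> (forall j v, v \in V j -> v *m g \in V j).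
Proof.
split=> [/borelP[h hV gh] j v vj|gV].
  by rewrite (gh j) //; have /orthogonal_onP[+ _] := hV j; apply.
have /choice[h hP] j : exists h : orthogonal_group R N,
    h \in orthogonal_on (V j) /\ forall v, v \in V j -> v *m g = v *m h.
  have [P [PT PV Pid P0]] := orthogonal_projector (V j).
  have PP : P *m P = P.
    by apply/row_matrixP => i; rewrite !rowE mulmxA Pid.
  have PgP : P *m g *m P = P *m g.
    by apply/row_matrixP => i; rewrite !rowE !mulmxA Pid // gV.
  have gP : P *m g^T *m P = g^T *m P.
    by rewrite -[RHS]trmxK trmx_mul PT trmxK -PgP !trmx_mul PT mulmxA.
  (* With [P] the projector onto [V j], this matrix is [g] on [V j] and the identity on its
     complement. Stability, as [PgP] and its transpose [gP], kills the cross terms. *)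
  have hO : (1%:M - P + P *m g) *m (1%:M - P + P *m g)^T == 1%:M.
    have -> : (1%:M - P + P *m g)^T = 1%:M - P + g^T *m P.
      by rewrite [LHS]linearD /= [(_ - _)^T]linearB /= trmx1 trmx_mul PT.
    have QQ : (1%:M - P) *m (1%:M - P) = 1%:M - P.
      by rewrite mulmxBl mul1mx mulmxBr mulmx1 PP subrr subr0.
    have QgP : (1%:M - P) *m (g^T *m P) = 0.
      by rewrite mulmxBl mul1mx mulmxA gP subrr.
    have PgQ : P *m g *m (1%:M - P) = 0 by rewrite mulmxBr mulmx1 PgP subrr.
    rewrite mulmxDl (mulmxDr (_ - _)) (mulmxDr (P *m g)) QQ QgP PgQ addr0 add0r.
    by rewrite mulmxA -(mulmxA P) Defs.orthogonalP mulmx1 PP subrK.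
  exists (Orthogonal hO); split=> [|v vj] /=; last first.
    by rewrite mulmxDr mulmxBr mulmx1 mulmxA Pid // subrr add0r.
  apply/orthogonal_onP; split=> [v vj|w /P0 wP] /=.
    by rewrite mulmxDr mulmxBr mulmx1 mulmxA Pid // subrr add0r gV.
  by rewrite mulmxDr mulmxBr mulmx1 mulmxA wP mul0mx addr0 subr0.
by apply/borelP; exists h => j; have [] := hP j.
Qed.

Lemma reflection_borel j u : u \in V j -> reflection u \in borel V.
Proof.
move=> uj; apply/borel_stableP => k v vk; rewrite mulmx_reflection.
have [kj|jk] := eqVneq k j; first by rewrite memvB ?memvZ // kj.
by rewrite (summand_orthogonal jk vk uj) mulr0 scale0r subr0.
Qed.

(* u is a sum of components u_k; the reflection moves a nonzero u_k by a
   nonzero multiple of u, and it preserves V k. *)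
Lemma reflection_borel_summand u :
  u != 0 -> reflection u \in borel V -> exists k, u \in V k.
Proof.
move=> u0 /borel_stableP sV; have [w wV uw] := summand_sumP u.
have /existsP[k wk0] : [exists k, w k != 0].
  apply: contraNT u0 => /existsPn w0; rewrite uw big1 // => k _.
  by apply/eqP; rewrite -[_ == _]negbK.
exists k; have := sV k _ (wV k); rewrite mulmx_reflection.
have -> : dotr (w k) u = dotr (w k) (w k).
  rewrite uw /dotr linear_sum /= mulmx_sumr summxE (bigD1 k) //= big1 ?addr0 //.
  by move=> i ik; apply: (summand_orthogonal _ (wV k) (wV i)); rewrite eq_sym.
set a := _ * _ => wa.
have a0 : a != 0 by rewrite !mulf_neq0 ?invr_eq0 ?dotr_eq0 ?pnatr_eq0.
by rewrite -[u](scalerK a0) memvZ // -[a *: u](subKr (w k)) memvB ?wV.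
Qed.

Lemma normalizer_img_sub g j : g \in normalizer (borel V) ->
  exists k, forall v, v \in V j -> v *m g \in V k.
Proof.
move=> /normalizerP gN.
(* The reflection along [v] lies in H, hence so does its conjugate, the reflection along
   [v *m g]. *)
have gV v : v \in V j -> exists k, v *m g \in V k.
  have [->|v0] := eqVneq v 0; first by exists j; rewrite mul0mx mem0v.
  move=> vj; apply: reflection_borel_summand.
    by rewrite -dotr_eq0 dotr_orthogonal dotr_eq0.
  by rewrite -reflection_conj gN (reflection_borel vj).
(* If u g lies in V k but v g lies in another V l, then (u + v) g lies in V k:
   otherwise u g would be orthogonal to (u + v) g and to v g, hence to itself. *)
have [u uj u0] := summand_neq0 j; have [k uk] := gV u uj.
exists k => v vj; have [l vl] := gV v vj.
have [<-//|lk] := eqVneq l k.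
have [m] := gV (u + v) (memvD uj vj).
have [->|mk] := eqVneq m k.
  by rewrite mulmxDl => uvk; rewrite -[v *m g](addKr (u *m g)) memvD ?memvN.
move=> uvm; have /eqP := summand_orthogonal mk uvm uk.
rewrite mulmxDl dotrDl (summand_orthogonal lk vl uk) addr0.
by rewrite dotr_orthogonal dotr_eq0 (negPf u0).
Qed.

(** * The permutation of the summands induced by an element of the normalizer *)

Lemma orthogonal_end_imgP g (U W : {vspace 'rV[R]_N}) :
  (forall v, v \in U -> v *m g \in W) ->
  (forall w, w \in W -> w *m g^-1%g \in U) ->
  (orthogonal_end g @: U)%VS = W.
Proof.
move=> UW WU; apply/eqP; rewrite eqEsubv; apply/andP; split; apply/subvP => w.
  by case/memv_imgP => v vU ->; rewrite orthogonal_endE UW.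
move=> wW; apply/memv_imgP; exists (w *m g^-1%g); first exact: WU.
by rewrite orthogonal_endE mulmx_orthogonalVK.
Qed.

Lemma orthogonal_end_inj g : lker (orthogonal_end g) = 0%VS.
Proof.
apply/eqP/lker0P => x y; rewrite !orthogonal_endE => xy.
by rewrite -(mulmx_orthogonalK g x) xy mulmx_orthogonalK.
Qed.

Lemma dim_orthogonal_end g (U : {vspace 'rV[R]_N}) :
  \dim (orthogonal_end g @: U) = \dim U.
Proof. by rewrite limg_dim_eq // orthogonal_end_inj capv0. Qed.

Lemma orthogonal_endM g h (U : {vspace 'rV[R]_N}) :
  (orthogonal_end (g * h)%g @: U
   = orthogonal_end h @: (orthogonal_end g @: U))%VS.
Proof.
rewrite -limg_comp; congr (lfun_img _ _); apply/lfunP => v.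
by rewrite comp_lfunE !orthogonal_endE /= mulmxA.
Qed.

Lemma borel_img g j : g \in borel V -> (orthogonal_end g @: V j)%VS = V j.
Proof.
move=> gH; have gVH : (g^-1)%g \in borel V by rewrite gpredV.
move/borel_stableP: gH => gH; move/borel_stableP: gVH => gVH.
by apply: orthogonal_end_imgP; [apply: gH | apply: gVH].
Qed.

Lemma img_borel g :
  (forall j, (orthogonal_end g @: V j)%VS = V j) -> g \in borel V.
Proof.
move=> gV; apply/borel_stableP => j v vj.
by rewrite -orthogonal_endE -gV memv_img.
Qed.

Lemma normalizer_img g j : g \in normalizer (borel V) ->
  exists k, (orthogonal_end g @: V j)%VS = V k.
Proof.
move=> gN; have [k gV] := normalizer_img_sub j gN.
have gVN : (g^-1)%g \in normalizer (borel V).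
  apply/normalizerP => h; move/normalizerP: gN => gN.
  by rewrite -[LHS]gN conjgKV.
have [l gVV] := normalizer_img_sub k gVN.
exists k; apply: orthogonal_end_imgP => // w /gVV.
(* A nonzero vector of [V j], sent by [g] into [V k] and back by [g^-1] into [V l], lies in both
   [V j] and [V l]. *)
suff -> : l = j by [].
have [u uj u0] := summand_neq0 j; apply: (summand_uniq u0) => //.
by rewrite -(mulmx_orthogonalK g u) gVV ?gV.
Qed.

(** As [g] is injective, two summands with the same image share a nonzero vector and so coincide; as
    [g] keeps dimensions, the permutation lies in [sym_partition]. *)
Lemma normalizer_perm g : g \in normalizer (borel V) ->
  exists s : [subg sym_partition (summand_dim V)],
    forall j, (orthogonal_end g @: V j)%VS = V (sgval s j).
Proof.
move=> gN; have [s sE] := choice (fun j => normalizer_img j gN).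
have s_inj : injective s.
  move=> i j sij; have [v vi v0] := summand_neq0 i; apply: (summand_uniq v0 vi).
  have : orthogonal_end g v \in (orthogonal_end g @: V j)%VS.
    by rewrite sE -sij -sE memv_img.
  case/memv_imgP => w wj.
  by have /eqP/lker0P gI := orthogonal_end_inj g; move=> /gI->.
have sP : perm s_inj \in sym_partition (summand_dim V).
  rewrite inE; apply/forallP => j.
  by rewrite /summand_dim permE -sE dim_orthogonal_end.
by exists (subg _ (perm s_inj)) => j; rewrite subgK // permE sE.
Qed.

Lemma permuting_inv g (s : 'S_r) :
  (forall j, (orthogonal_end g @: V j)%VS = V (s j)) ->
  forall j, (orthogonal_end g^-1%g @: V j)%VS = V (s^-1%g j).
Proof.
move=> gV j; rewrite -{1}[j](permKV s) -gV -orthogonal_endM mulgV.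
rewrite -[RHS]lim1g; congr (lfun_img _ _); apply/lfunP => v.
by rewrite orthogonal_endE id_lfunE mulmx1.
Qed.

(** Conjugating by [g] only relabels the summands by [s], so stabilising all of them is invariant
    under conjugation. *)
Lemma permuting_normalizer g (s : 'S_r) :
  (forall j, (orthogonal_end g @: V j)%VS = V (s j)) ->
  g \in normalizer (borel V).
Proof.
move=> gV.
have gVV := permuting_inv gV.
apply/normalizerP => h; apply/idP/idP => hH; apply: img_borel => j.
  have -> : h = (g * (h ^ g) * g^-1)%g by rewrite conjgE !mulgA mulgV mul1g mulgK.
  rewrite (orthogonal_endM _ g^-1%g) (orthogonal_endM g) gV borel_img //.
  by rewrite gVV permK.
by rewrite conjgE !orthogonal_endM gVV borel_img // gV permKV.
Qed.

Lemma perm_orthogonal (s : [subg sym_partition (summand_dim V)]) :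
  exists g, forall j, (orthogonal_end g @: V j)%VS = V (sgval s j).
Proof.
have dimV j : \dim (V (sgval s j)) = \dim (V j).
  by have := subgP s; rewrite inE => /forallP/(_ j)/eqP.
have /all_sig[B BP] j := cid (orthonormal_frame (erefl (\dim (V j)))).
(* The frame of [V (sgval s j)] is indexed by [\dim (V j)] through [dimV], so that its rows match
   those of [B j]. *)
have /all_sig[C CP] j := cid (orthonormal_frame (dimV j)).
have vB j w : w \in V j -> w *m (B j)^T *m B j = w.
  by case/(BP j).2 => u ->; rewrite -(mulmxA u) (BP j).1 mulmx1.
have vB0 i j w : w \in V i -> i != j -> w *m (B j)^T = 0.
  move=> wi ij; apply: frame_orthogonal => u.
  by apply: (summand_orthogonal ij wi); apply/(BP j).2; exists u.
have CC0 i j : i != j -> C i *m (C j)^T = 0.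
  move=> ij; apply/row_matrixP => a; rewrite row_mul row0 rowE.
  apply: frame_orthogonal => u.
  apply: (@summand_orthogonal _ _ _ V (sgval s i) (sgval s j)).
  - by rewrite (inj_eq perm_inj).
  - by apply/(CP i).2; exists (delta_mx 0 a).
  - by apply/(CP j).2; exists u.
(* This sends the rows of each [B j] to the corresponding rows of [C j]. *)
pose g : 'M[R]_N := \sum_j (B j)^T *m C j.
have gE j w : w \in V j -> w *m g = w *m (B j)^T *m C j.
  move=> wj; rewrite mulmx_sumr (bigD1 j) //= mulmxA big1 ?addr0 // => i ij.
  by rewrite mulmxA (vB0 j) ?mul0mx // eq_sym.
have gO : g *m g^T == 1%:M.
  apply/eqP/eq_mx_on_summands => j w wj; rewrite mulmxA (gE j) // mulmx1.
  rewrite linear_sum mulmx_sumr (bigD1 j) //= trmx_mul trmxK.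
  rewrite mulmxA -(mulmxA _ (C j)) (CP j).1 mulmx1 vB // big1 ?addr0 // => i ij.
  by rewrite trmx_mul trmxK mulmxA -(mulmxA _ (C j)) CC0 1?eq_sym // mulmx0 mul0mx.
exists (Orthogonal gO) => j; apply/eqP; rewrite eqEdim dim_orthogonal_end.
rewrite dimV leqnn andbT; apply/subvP => _ /memv_imgP[w wj ->].
by rewrite orthogonal_endE /= (gE j) //; apply/(CP j).2; eexists.
Qed.

(** The induced permutation is constant on cosets because H fixes every summand, and its kernel is H
    because fixing every summand characterises H. Surjectivity is [perm_orthogonal]. *)
Lemma weyl_iso :
  exists Phi : {multiplicative
                  weyl (borel V) -> [subg sym_partition (summand_dim V)]},
    bijective Phi /\
    (forall (g : normalizer_group (borel V)) (j : 'I_r),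
       (orthogonal_end (val g) @: V j)%VS
         = V (sgval (Phi (\pi_(weyl (borel V)) g)%qT) j)).
Proof.
have [f fE] := choice (fun g : normalizer_group (borel V) =>
                         normalizer_perm (valP g)).
(* Distinct indices have distinct summands, so the chosen permutation is the only possible one; this
   identifies every later value of [f]. *)
have f_uniq x (s : [subg sym_partition (summand_dim V)]) :
    (forall j, (orthogonal_end (val x) @: V j)%VS = V (sgval s j)) -> f x = s.
  move=> xs; apply: val_inj; apply/permP => j.
  by apply: summand_inj; rewrite -fE xs.
have same_f x y : same_coset x y -> f x = f y.
  move=> xy; apply/esym/f_uniq => j; rewrite -[val y](mulKVg (val x)).
  by rewrite orthogonal_endM fE borel_img.
pose F (x : weyl (borel V)) := f (repr x).
have FE x : F (\pi_(weyl (borel V)) x)%qT = f x.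
  by apply: same_f; apply/same_cosetP; rewrite reprK.
have FM : {morph F : x y / (x * y)%g}.
  elim/quotW=> x; elim/quotW=> y.
  rewrite -[(_ * _)%g]pi_weyl_mul !FE; apply: f_uniq => j.
  by rewrite valM orthogonal_endM !fE permM.
have [Phi PhiE] := multiplicative_exists FM.
exists Phi; split; last by move=> g j; rewrite PhiE FE fE.
have Phi_inj : injective Phi.
  elim/quotW=> x; elim/quotW=> y; rewrite !PhiE !FE => fxy.
  (* If [x] and [y] induce the same permutation, [x^-1 * y] fixes each summand. *)
  apply/same_cosetP; rewrite /same_coset; apply: img_borel => j.
  by rewrite orthogonal_endM (permuting_inv (fE x)) fE -fxy permKV.
suff /choice[G GK] : forall s, exists x, Phi x = s.
  by exists G => // x; apply: Phi_inj; rewrite GK.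
move=> s; have [g gs] := perm_orthogonal s.
have gN := permuting_normalizer gs.
exists (\pi_(weyl (borel V)) (Sub g gN : normalizer_group _))%qT.
by rewrite PhiE FE; apply: f_uniq => j; rewrite SubK.
Qed.

End OrthogonalDecomposition.

(** * Assembling the Weyl group isomorphism and the two product decompositions *)

Theorem corollary3p11 (R : realType) (N r : nat)
    (V : orthogonal_decomposition R N r)
    (q : nat) (n : q.-tuple nat)
    (n_uniq : uniq n) (n_values : n =i codom (summand_dim V)) :
  exists (Phi : {multiplicative
                   weyl (borel V) -> [subg sym_partition (summand_dim V)]})
         (Psi : {multiplicative [subg sym_partition (summand_dim V)] ->
                   {dffun forall i : 'I_q,
                      sym_group (phi (summand_dim V) (tnth n i))}})
         (Theta : {multiplicative [subg sym_partition (summand_dim V)] ->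
                   {dffun forall i : 'I_N,
                      sym_group (phi (summand_dim V) i.+1)}}),
    [/\ bijective Phi /\
        (forall (g : normalizer_group (borel V)) (j : 'I_r),
           (orthogonal_end (val g) @: V j)%VS
             = V (sgval (Phi (\pi_(weyl (borel V)) g)%qT) j)),
        bijective Psi /\
        (forall s i x, val (Psi s i x) = sgval s (val x)) &
        bijective Theta /\
        (forall s i x, val (Theta s i x) = sgval s (val x))].
Proof.
have [Phi PhiP] := weyl_iso V.
have n_inj : injective (tnth n) by apply/tuple_uniqP.
have n_onto j : exists i, summand_dim V j = tnth n i.
  by apply/tnthP; rewrite n_values codom_f.
have [Psi PsiP] := sym_partition_prod n_inj n_onto.
(* The index [i : 'I_N] starts at 0 and stands for the dimension [i.+1]; summand dimensions range
   over 1 to [N]. *)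
have succ_inj : injective (fun i : 'I_N => i.+1) by move=> i k [] /val_inj.
have succ_onto j : exists i : 'I_N, summand_dim V j = i.+1.
  have dimN : (\dim (V j) <= N)%N.
    by rewrite (leq_trans (dimvS (subvf _))) // dimvf /dim /= mul1n.
  have := summand_dim_gt0 V j; rewrite /summand_dim; move: dimN.
  by case: (\dim _) => // d dN _; exists (Ordinal dN).
have [Theta ThetaP] := sym_partition_prod succ_inj succ_onto.
by exists Phi, Psi, Theta.
Qed.
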